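(* Let $m\geq 0$ be an integer. Let the premiums $\{X_n, n\geq 1\}$ and the claims $\{Y_n, n\geq 1\}$ be sequences of nonnegative, identically distributed, $m$-dependent random variables with finite expectations, and let the rates of interest $\{I_n, n\geq 1\}$ be a sequence of i.i.d. nonnegative random variables with finite expectations. Suppose that the sequences $\{X_n\}$, $\{Y_n\}$, $\{I_n\}$ are mutually independent. For $u\geq 0$ define the surplus process by $U_0=u$ and $$U_n=(U_{n-1}+X_n)(1+I_n)-Y_n,\quad n\geq 1,$$ and the ultimate ruin probability $\Psi(u)=\mathbb{P}\big(\bigcup_{n=1}^\infty \{U_n<0\}\big)$. If there exists a positive real number $R$ satisfying $$\mathbb{E}\Big(e^{R\left(Y_1(1+I_1)^{-1}-X_1\right)}\Big)\leq 1,$$ then $$\Psi(u)\leq (m+1)e^{-R\frac{u}{m+1}}\quad\text{for all } u>\frac{(m+1)\ln(m+1)}{R}.$$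
   Context: A sequence of random variables $\{X_n, n\geq 1\}$ is called $m$-dependent (for a fixed nonnegative integer $m$) if the $\sigma$-algebras $\sigma\{X_1,\dots,X_n\}$ and $\sigma\{X_{n+k},X_{n+k+1},\dots\}$ are independent for all $k\geq m+1$ and all $n\geq 1$. In particular, $0$-dependence is independence. *)

(* Defs.v *)
From HB Require Import structures.
From mathcomp Require Import all_boot all_order all_algebra.
From mathcomp Require Import all_classical all_reals all_analysis.
Set Implicit Arguments. Unset Strict Implicit. Unset Printing Implicit Defensive.
Import Order.TTheory GRing.Theory Num.Theory.
Import numFieldNormedType.Exports.
Local Open Scope classical_set_scope.
Local Open Scope ring_scope.

Section Defs.
Context {d : measure_display} {T : measurableType d} {R : realType}.

Definition gen_sigma (Ix : set nat) (X : nat -> T -> R) : set (set T) :=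
  <<s setT, [set A | exists i, Ix i /\ exists B : set R,
                   measurable B /\ A = X i @^-1` B] >>.

Definition indep_sets (P : probability T R) (F G : set (set T)) : Prop :=
  forall A B, F A -> G B -> P (A `&` B) = (P A * P B)%E.

(* m-dependence (indices shifted: X 0 is X_1) *)
Definition m_dependent (P : probability T R) (m : nat) (X : nat -> T -> R) :=
  forall n k, (m.+1 <= k)%N ->
    indep_sets P (gen_sigma [set i | (i <= n)%N] X)
                 (gen_sigma [set i | (n + k <= i)%N] X).

Definition ident_distr (P : probability T R) (X : nat -> T -> R) :=
  forall n (B : set R), measurable B -> P (X n @^-1` B) = P (X 0%N @^-1` B).

(* mutual independence of the sequence: product rule over every finite
   initial segment (setT belongs to each sigma-algebra, so this covers every
   finite subfamily) *)
Definition mutually_indep (P : probability T R) (X : nat -> T -> R) :=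
  forall n (A : nat -> set T),
    (forall i, (i < n)%N -> gen_sigma [set i] X (A i)) ->
    P (\big[setI/setT]_(i < n) A i) = (\prod_(i < n) P (A i))%E.

Definition indep3 (P : probability T R) (X Y Z : nat -> T -> R) :=
  forall A B C, gen_sigma setT X A -> gen_sigma setT Y B ->
    gen_sigma setT Z C -> P (A `&` B `&` C) = (P A * P B * P C)%E.

(* surplus process: U 0 = u, U (n+1) = (U n + X_{n+1})(1 + I_{n+1}) - Y_{n+1};
   with shifted indices X n stands for X_{n+1}. *)
Fixpoint surplus (X Y I : nat -> T -> R) (u : R) (n : nat) (t : T) : R :=
  match n with
  | 0%N => u
  | n'.+1 => (surplus X Y I u n' t + X n' t) * (1 + I n' t) - Y n' t
  end.

Definition ruin_prob (P : probability T R) (X Y I : nat -> T -> R) (u : R) :=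
  P (\bigcup_n [set t | surplus X Y I u n.+1 t < 0]).

End Defs.

(* Main.v *)
Require Import Defs.
From HB Require Import structures.
From mathcomp Require Import all_boot all_order all_algebra.
From mathcomp Require Import all_classical all_reals all_analysis.
From mathcomp Require Import measurable_realfun ring zify.
Set Implicit Arguments.
Unset Strict Implicit.
Unset Printing Implicit Defensive.
Import Order.TTheory GRing.Theory Num.Theory.
Import numFieldNormedType.Exports.
Local Open Scope classical_set_scope.
Local Open Scope ring_scope.

(** Put Z_n = Y_n / (1 + I_n) - X_n and D_n = \prod_(j < n) (1 + I_j)^-1, so
    that the discounted surplus is U_n D_n = u - \sum_(i < n) D_i Z_i. Ruin
    forces one of the m + 1 partial sums over a residue class of i modulo m + 1
    to exceed u / (m + 1). Consecutive indices of a class are m + 1 apart, so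
    within a class Z_n is independent of the past, to which D_n and the previous
    terms belong. Since 0 <= D_n <= 1, convexity gives
    exp(R D_n Z_n) <= D_n exp(R Z_n) + 1 - D_n, which makes the exponential of R
    times each class sum a supermartingale. By Ville's maximal inequality, a
    class sum ever exceeds u / (m + 1) with probability at most
    exp(- R u / (m + 1)). *)

Lemma sum_residue_classes (V : nmodType) (f : nat -> V) (k n : nat) :
  \sum_(i < n) f i =
  \sum_(r < k.+1) \sum_(l < (n + k - r) %/ k.+1) f (l * k.+1 + r)%N.
Proof.
elim: n => [|n IHn].
  rewrite big_ord0 big1// => r _; rewrite divn_small ?big_ord0//.
  by rewrite add0n ltnS leq_subr.
have countS (r : 'I_k.+1) : ((n.+1 + k - r) %/ k.+1 =
    (r == n %% k.+1 :> nat) + (n + k - r) %/ k.+1)%N.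
  have rk := ltn_ord r.
  have -> : (n.+1 + k - r = (n + k - r).+1)%N by lia.
  rewrite divnS//; have -> : ((n + k - r).+1 = n + k.+1 - r)%N by lia.
  rewrite -eqn_mod_dvd ?modnDr ?(modn_small rk); last by lia.
  by rewrite eq_sym.
have quotE : ((n + k - n %% k.+1) %/ k.+1 = n %/ k.+1)%N.
  rewrite [X in (X + k - _)%N](divn_eq n k.+1) addnAC addnK divnMDl//.
  by rewrite (@divn_small k)// addn0.
pose s : 'I_k.+1 := Ordinal (ltn_pmod n (ltn0Sn k)).
rewrite big_ord_recr IHn [LHS]/= (bigD1 s)// [RHS](bigD1 s)//=.
rewrite (countS s) eqxx add1n [in RHS]big_ord_recr /= addrAC.
rewrite quotE -divn_eq; congr (_ + _ + _).
by apply: eq_bigr => r; rewrite -val_eqE countS => /negbTE ->.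
Qed.

Section measurability.
Context {d : measure_display} {T : measurableType d} {R : realType}.
Implicit Types f : T -> R.

Lemma measurable_inv : measurable_fun [set: R] GRing.inv.
Proof.
have mset0 : measurable [set (0 : R)] by exact: measurable_set1.
rewrite -(setvU [set 0]); apply/measurable_funU => //; first exact: measurableC.
split; last first.
  apply: (eq_measurable_fun (cst (0 : R))) => // x.
  by rewrite inE => ->; rewrite invr0.
apply: open_continuous_measurable_fun => [|x].
  exact/closed_openC/accessible_closed_set1/hausdorff_accessible/Rhausdorff.
by rewrite inE => /eqP x0; exact: inv_continuous.
Qed.

Lemma measurable_funV f :
  measurable_fun setT f -> measurable_fun setT (fun t => (f t)^-1).
Proof. exact: measurableT_comp measurable_inv. Qed.

Lemma measurable_superlevel f v :
  measurable_fun setT f -> measurable [set t | v < f t].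
Proof.
move=> /measurable_EFinP mf; rewrite -[X in measurable X]setTI.
exact: (emeasurable_fun_o_infty measurableT mf v%:E).
Qed.

End measurability.

Section integral_EFin.
Context {d : measure_display} {T : measurableType d} {R : realType}.
Variables (mu : {measure set T -> \bar R}) (D : set T).
Hypothesis mD : measurable D.
Variables f g : T -> R.
Hypotheses (mf : measurable_fun setT f) (mg : measurable_fun setT g).
Hypothesis f0 : forall t, 0 <= f t.
Local Open Scope ereal_scope.

Lemma ge0_integral_EFinD : (forall t, (0 <= g t)%R) ->
  \int[mu]_(t in D) (f t + g t)%:E =
  \int[mu]_(t in D) (f t)%:E + \int[mu]_(t in D) (g t)%:E.
Proof.
move=> g0; under eq_integral do rewrite EFinD.
rewrite ge0_integralD//; try by move=> t _; rewrite lee_fin.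
- by apply/measurable_EFinP; exact: measurable_funTS.
- by apply/measurable_EFinP; exact: measurable_funTS.
Qed.

Lemma ge0_le_integral_EFin : (forall t, (f t <= g t)%R) ->
  \int[mu]_(t in D) (f t)%:E <= \int[mu]_(t in D) (g t)%:E.
Proof.
move=> fg; apply: ge0_le_integral => //.
- by move=> t _; rewrite lee_fin.
- by apply/measurable_EFinP; exact: measurable_funTS.
- by apply/measurable_EFinP; exact: measurable_funTS.
- by move=> t _; rewrite lee_fin.
Qed.

End integral_EFin.

Section generated_sigma_algebras.
Context {d : measure_display} {T : measurableType d}.
Implicit Types F G : set_system T.

Lemma g_sigma_algebra_measurable F :
  F `<=` measurable -> <<s F >> `<=` measurable.
Proof.
by move=> Fm; apply: smallest_sub => //; exact: sigma_algebra_measurable.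
Qed.

Lemma measurable_fun_g_sigma_algebra {d' : measure_display}
    {T' : measurableType d'} F (f : T -> T') :
  F `<=` measurable -> measurable_fun [set: g_sigma_algebraType F] f ->
  measurable_fun setT f.
Proof.
move=> Fm mf _ B mB; apply: (g_sigma_algebra_measurable Fm).
exact: (mf measurableT B mB).
Qed.

Lemma measurable_fun_g_sigma_algebraS {d' : measure_display}
    {T' : measurableType d'} F G (f : T -> T') : <<s F >> `<=` <<s G >> ->
  measurable_fun [set: g_sigma_algebraType F] f ->
  measurable_fun [set: g_sigma_algebraType G] f.
Proof. by move=> FG mf _ B mB; apply: FG; exact: mf. Qed.

Lemma g_sigma_algebraT F : <<s F >> setT.
Proof. exact: (@measurableT _ (g_sigma_algebraType F)). Qed.

Lemma g_sigma_algebraI F : setI_closed <<s F >>.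
Proof. exact: (@measurableI _ (g_sigma_algebraType F)). Qed.

Lemma g_sigma_algebra_preimage_sub {d' : measure_display}
    {T' : measurableType d'} F (f : T -> T') :
  measurable_fun [set: g_sigma_algebraType F] f ->
  g_sigma_algebra_preimage f `<=` <<s F >>.
Proof. by move=> mf _ [B mB <-]; exact: mf. Qed.

Lemma g_sigma_algebra_preimage_comp {d1 d2 : measure_display}
    {T1 : measurableType d1} {T2 : measurableType d2}
    (f : T -> T1) (h : T1 -> T2) : measurable_fun setT h ->
  g_sigma_algebra_preimage (h \o f) `<=` g_sigma_algebra_preimage f.
Proof.
move=> mh _ [B mB <-]; exists (h @^-1` B) => //.
by rewrite -[X in measurable X]setTI; exact: mh.
Qed.

End generated_sigma_algebras.

Section independence.
Context {d : measure_display} {T : measurableType d} {R : realType}.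
Variable P : probability T R.
Implicit Types F G : set_system T.

Lemma indep_setsC F G : indep_sets P F G -> indep_sets P G F.
Proof. by move=> FG A B GA FB; rewrite setIC FG// muleC. Qed.

Lemma indep_setsS F F' G G' : F' `<=` F -> G' `<=` G ->
  indep_sets P F G -> indep_sets P F' G'.
Proof. by move=> FF GG FG A B /FF FA /GG GB; exact: FG. Qed.

Lemma indep_sets_trivial G :
  G `<=` measurable -> indep_sets P [set set0; setT] G.
Proof.
move=> Gm A B [->|->] /Gm mB; first by rewrite set0I measure0 mul0e.
by rewrite setTI probability_setT mul1e.
Qed.

(* Both sides of the product rule are finite measures in A, and they agree on
   the pi-system F. *)
Lemma indep_sets_g_sigma_algebral F G :
  F `<=` measurable -> G `<=` measurable -> setI_closed F -> F setT ->
  indep_sets P F G -> indep_sets P <<s F >> G.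
Proof.
move=> Fm Gm FI FT FG A B FA GB.
have mB : measurable B by exact: Gm.
have PBE : (fine (P B))%:E = P B by rewrite fineK// fin_num_measure.
have PB0 : 0 <= fine (P B) by rewrite fine_ge0.
pose scaledP := mscale (NngNum PB0) P.
have scaledPE C : scaledP C = (P C * P B)%E.
  by rewrite /scaledP /mscale/= PBE muleC.
rewrite -scaledPE; change (mrestr P mB A = scaledP A).
apply: (g_sigma_algebra_measure_unique F Fm (fun=> setT)) => //.
- by rewrite bigcup_const//; exists 0%N.
- by move=> C FC; rewrite [RHS]scaledPE -FG.
- move=> _; change (P (setT `&` B) < +oo)%E.
  by rewrite ltey_eq fin_num_measure// setTI.
Qed.

Lemma indep_sets_g_sigma_algebra F G : F `<=` measurable -> G `<=` measurable ->
  setI_closed F -> F setT -> setI_closed G -> G setT ->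
  indep_sets P F G -> indep_sets P <<s F >> <<s G >>.
Proof.
move=> Fm Gm FI FT GI GT FG.
apply/indep_setsC/indep_sets_g_sigma_algebral => //.
  exact: g_sigma_algebra_measurable.
exact/indep_setsC/indep_sets_g_sigma_algebral.
Qed.

End independence.

Section independent_functions.
Context {d d1 d2 : measure_display} {T : measurableType d}.
Context {T1 : measurableType d1} {T2 : measurableType d2} {R : realType}.
Variable P : probability T R.

Definition indep_funs (f : T -> T1) (g : T -> T2) : Prop :=
  indep_sets P (g_sigma_algebra_preimage f) (g_sigma_algebra_preimage g).

Lemma measure_pair_indep (f : {mfun T >-> T1}) (g : {mfun T >-> T2})
    (E : set (T1 * T2)) : indep_funs f g -> measurable E ->
  P ((fun t => (f t, g t)) @^-1` E) =
  (distribution P f \x distribution P g)%E E.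
Proof.
move=> fg mE.
have mfg : measurable_fun setT (fun t => (f t, g t)).
  exact: measurable_fun_pair.
rewrite -[LHS]/(distribution P (mfun_Sub (mem_set mfg)) E).
apply/esym/product_measure_unique => // A B mA mB.
by rewrite -fg//; [exists A|exists B] => //; rewrite setTI.
Qed.

End independent_functions.

Definition same_law {d d1 : measure_display} {T : measurableType d}
    {T1 : measurableType d1} {R : realType} (P : probability T R)
    (f g : T -> T1) : Prop :=
  forall A, measurable A -> P (f @^-1` A) = P (g @^-1` A).

Section laws.
Context {d d1 d2 : measure_display} {T : measurableType d}.
Context {T1 : measurableType d1} {T2 : measurableType d2} {R : realType}.
Context {P : probability T R}.
Local Open Scope ereal_scope.

Lemma ge0_integral_same_law (f g : T -> T1) (h : T1 -> \bar R) :
  measurable_fun setT f -> measurable_fun setT g -> same_law P f g ->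
  measurable_fun setT h -> (forall x, 0 <= h x) ->
  \int[P]_t h (f t) = \int[P]_t h (g t).
Proof.
move=> mf mg fg mh h0.
rewrite -[LHS](ge0_integral_distribution (mfun_Sub (mem_set mf)))//.
rewrite -[RHS](ge0_integral_distribution (mfun_Sub (mem_set mg)))//.
by apply: eq_measure_integral => A mA _; exact: fg.
Qed.

Lemma same_law_pair (f f' : T -> T1) (g g' : T -> T2) :
  measurable_fun setT f -> measurable_fun setT f' ->
  measurable_fun setT g -> measurable_fun setT g' ->
  indep_funs P f g -> indep_funs P f' g' ->
  same_law P f f' -> same_law P g g' ->
  same_law P (fun t => (f t, g t)) (fun t => (f' t, g' t)).
Proof.
move=> mf mf' mg mg' fg fg' ff gg E mE.
pose F : {mfun T >-> T1} := mfun_Sub (mem_set mf).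
pose F' : {mfun T >-> T1} := mfun_Sub (mem_set mf').
pose G : {mfun T >-> T2} := mfun_Sub (mem_set mg).
pose G' : {mfun T >-> T2} := mfun_Sub (mem_set mg').
rewrite -[LHS]/(P ((fun t => (F t, G t)) @^-1` E)).
rewrite (measure_pair_indep (f := F) (g := G) fg mE).
rewrite -[RHS]/(P ((fun t => (F' t, G' t)) @^-1` E)).
rewrite (measure_pair_indep (f := F') (g := G') fg' mE).
transitivity (\int[distribution P F]_x distribution P G' (xsection E x)).
  by apply: eq_integral => x _; exact/gg/measurable_xsection.
by apply: eq_measure_integral => A mA _; exact: ff.
Qed.

Lemma ge0_integralM_indep (f g : T -> R) :
  measurable_fun setT f -> measurable_fun setT g -> indep_funs P f g ->
  (forall t, (0 <= f t)%R) -> (forall t, (0 <= g t)%R) ->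
  \int[P]_t (f t * g t)%:E = (\int[P]_t (f t)%:E) * (\int[P]_t (g t)%:E).
Proof.
move=> mf mg fg f0 g0.
pose F : {mfun T >-> R} := mfun_Sub (mem_set mf).
pose G : {mfun T >-> R} := mfun_Sub (mem_set mg).
have mabs : measurable_fun setT (fun x : R => `|x|%:E).
  by apply/measurable_EFinP; exact: normr_measurable.
have abs_ge0 (x : R) : 0 <= `|x|%:E by rewrite lee_fin.
have int_law (h : {mfun T >-> R}) : (forall t, (0 <= h t)%R) ->
    \int[P]_t (h t)%:E = \int[distribution P h]_x `|x|%:E.
  move=> h0; rewrite ge0_integral_distribution//.
  by apply: eq_integral => t _ /=; rewrite ger0_norm.
pose absM (z : R * R) := `|z.1|%:E * `|z.2|%:E.
have mabsM : measurable_fun setT absM.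
  by apply: emeasurable_funM; apply: (measurableT_comp mabs);
    [exact: measurable_fst|exact: measurable_snd].
have absM0 z : 0 <= absM z by rewrite mule_ge0.
have mFG : measurable_fun setT (fun t => (F t, G t)).
  exact: measurable_fun_pair.
transitivity (\int[distribution P (mfun_Sub (mem_set mFG))]_z absM z).
  rewrite ge0_integral_distribution//; apply: eq_integral => t _ /=.
  by rewrite /absM/= EFinM !ger0_norm.
transitivity (\int[distribution P F \x distribution P G]_z absM z).
  apply: eq_measure_integral => A mA _.
  exact: (measure_pair_indep (f := F) (g := G) fg mA).
rewrite fubini_tonelli1// (int_law F)// (int_law G)//.
rewrite -ge0_integralZr//; last exact: integral_ge0.
by apply: eq_integral => x _; rewrite -ge0_integralZl.
Qed.

End laws.

Lemma expR_le_convex01 {R : realType} (a x : R) : 0 <= a <= 1 ->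
  expR (a * x) <= a * expR x + (1 - a).
Proof.
move=> /andP[a0 a1]; have := convex_expR (Itv01 a0 a1) x 0.
by rewrite !convRE /= expR0 mulr0 addr0 mulr1.
Qed.

Section supermartingales.
Context {d : measure_display} {T : measurableType d} {R : realType}.
Variable mu : {measure set T -> \bar R}.
Implicit Types (G : nat -> set_system T) (M : nat -> T -> R).
Local Open Scope ereal_scope.

(* A filtration is given by generators: the sigma-algebra at time n is
   <<s G n >>, so that measurability at time n is measurability on
   g_sigma_algebraType (G n). *)
Definition filtration G : Prop :=
  (forall n, G n `<=` measurable) /\ (forall n, <<s G n >> `<=` <<s G n.+1 >>).

Definition adapted G M : Prop :=
  forall n, measurable_fun [set: g_sigma_algebraType (G n)] (M n).

Definition supermartingale G M : Prop := adapted G M /\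
  forall n A, <<s G n >> A ->
    \int[mu]_(t in A) (M n.+1 t)%:E <= \int[mu]_(t in A) (M n t)%:E.

Lemma filtration_le G m n :
  filtration G -> (m <= n)%N -> <<s G m >> `<=` <<s G n >>.
Proof.
move=> [_ GS] /subnK <-; elim: (n - m)%N => // k IHk.
exact: subset_trans IHk (GS _).
Qed.

Lemma adapted_measurable G M n : filtration G -> adapted G M ->
  measurable_fun setT (M n).
Proof. by move=> [Gm _] /(_ n); exact: measurable_fun_g_sigma_algebra. Qed.

Lemma le_integral_superlevel (D : set T) (f : T -> R) (v : R) :
  measurable D -> measurable_fun setT f ->
  (forall t, (0 <= f t)%R) -> (0 <= v)%R ->
  v%:E * mu (D `&` [set t | (v < f t)%R]) +
    \int[mu]_(t in D `\` [set t | (v < f t)%R]) (f t)%:E <=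
  \int[mu]_(t in D) (f t)%:E.
Proof.
move=> mD mf f0 v0; set L := [set t | _].
have mL : measurable L by exact: measurable_superlevel.
have mDL : measurable (D `&` L) by exact: measurableI.
have mfE A : measurable_fun A (EFin \o f).
  by apply/measurable_EFinP; exact: measurable_funTS.
rewrite -{3}(setUIDK D L) ge0_integral_setU//; last 3 first.
- exact: measurableD.
- by move=> t _; rewrite lee_fin.
- by rewrite disj_set2E; apply/eqP; rewrite -subset0 => t [[_ Lt] [_]].
rewrite leeD2r// -integral_cst//; apply: ge0_le_integral => //.
by move=> t [_ /ltW]; rewrite lee_fin.
Qed.

Definition exceeded M (v : R) n : set T :=
  \big[setU/set0]_(j < n) [set t | (v < M j t)%R].

Lemma exceededS M v n :
  exceeded M v n.+1 = exceeded M v n `|` [set t | (v < M n t)%R].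
Proof. by rewrite /exceeded big_ord_recr. Qed.

Lemma exceeded_past G M v n : filtration G -> adapted G M ->
  <<s G n >> (exceeded M v n.+1).
Proof.
move=> filtG adM.
apply: (@bigsetU_measurable _ (g_sigma_algebraType (G n))) => j _.
apply: (filtration_le filtG); first by rewrite -ltnS.
exact: (@measurable_superlevel _ (g_sigma_algebraType (G j))).
Qed.

Lemma measurable_exceeded G M v n : filtration G -> adapted G M ->
  measurable (exceeded M v n).
Proof.
move=> filtG adM; apply: bigsetU_measurable => j _.
by apply: measurable_superlevel; exact: adapted_measurable adM.
Qed.

(* Stop the process when it first exceeds v. *)
Lemma supermartingale_stopped_le G M (v : R) n :
  filtration G -> supermartingale G M ->
  (forall n t, (0 <= M n t)%R) -> (0 <= v)%R ->
  v%:E * mu (exceeded M v n) + \int[mu]_(t in ~` exceeded M v n) (M n t)%:E <=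
  \int[mu]_t (M 0 t)%:E.
Proof.
move=> filtG [adM superM] M0 v0; pose E := exceeded M v.
have mM k : measurable_fun setT (M k) by exact: adapted_measurable adM.
have mE k : measurable (E k) by exact: measurable_exceeded adM.
elim: n => [|n]; first by rewrite /exceeded big_ord0 measure0 mule0 add0e setC0.
apply: le_trans; rewrite -!/(E _); set L := [set t | (v < M n t)%R].
have mL : measurable L by exact: measurable_superlevel.
have mEC : measurable (~` E n) by exact: measurableC.
have ES : E n.+1 = E n `|` L by exact: exceededS.
have -> : mu (E n.+1) = mu (E n) + mu (~` E n `&` L).
  rewrite -measureU//; last by rewrite setIA setICr set0I.
    by rewrite setUIr setUv setTI ES.
  exact: measurableI.
rewrite ge0_muleDr// -addeA leeD2l//.
apply: le_trans (le_integral_superlevel mEC (mM n) (M0 n) v0).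
rewrite leeD2l// setDE -setCU -ES; apply: superM.
apply: (@measurableC _ (g_sigma_algebraType (G n))).
exact: exceeded_past.
Qed.

Lemma supermartingale_maximal_ineq G M (v : R) :
  filtration G -> supermartingale G M ->
  (forall n t, (0 <= M n t)%R) -> (0 <= v)%R ->
  v%:E * mu (\bigcup_n [set t | (v < M n t)%R]) <= \int[mu]_t (M 0 t)%:E.
Proof.
move=> filtG superM M0 v0.
have mexceeded n : measurable (exceeded M v n.+1).
  exact: measurable_exceeded superM.1.
rewrite -bigcup_bigsetU_bigcup.
have cvg_mass : v%:E * mu (exceeded M v n.+1) @[n --> \oo] -->
    v%:E * mu (\bigcup_n exceeded M v n.+1).
  apply: cvgeZl => //; apply: nondecreasing_cvg_mu => //.
    exact: bigcup_measurable.
  apply/nondecreasing_seqP => n; apply/subsetPset.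
  by rewrite (exceededS _ _ n.+1).
rewrite -(cvg_lim _ cvg_mass)//; apply: lime_le.
  by apply/cvg_ex; eexists; exact: cvg_mass.
apply: nearW => n.
apply: le_trans (supermartingale_stopped_le n.+1 filtG superM M0 v0).
by rewrite leeDl// integral_ge0// => t _; rewrite lee_fin.
Qed.

End supermartingales.

Section exponential_supermartingale_step.
Context {d : measure_display} {T : measurableType d} {R : realType}.
Variable P : probability T R.
Implicit Types (F : set_system T) (f g a z : T -> R).
Local Open Scope ereal_scope.

Lemma indep_funs_g_sigma_algebra F f g :
  indep_sets P <<s F >> (g_sigma_algebra_preimage g) ->
  measurable_fun [set: g_sigma_algebraType F] f -> indep_funs P f g.
Proof.
by move=> Fg /g_sigma_algebra_preimage_sub fF; exact: indep_setsS Fg.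
Qed.

Lemma ge0_integral_setM_indep F (A : set T) f g :
  F `<=` measurable -> <<s F >> A ->
  measurable_fun [set: g_sigma_algebraType F] f -> (forall t, (0 <= f t)%R) ->
  measurable_fun setT g -> (forall t, (0 <= g t)%R) ->
  indep_sets P <<s F >> (g_sigma_algebra_preimage g) ->
  \int[P]_(t in A) (f t * g t)%:E =
  (\int[P]_(t in A) (f t)%:E) * \int[P]_t (g t)%:E.
Proof.
move=> Fm FA mf f0 mg g0 Fg.
have integral_setE h : \int[P]_(t in A) (h t)%:E = \int[P]_t (h t * \1_A t)%:E.
  rewrite integral_mkcond; apply: eq_integral => t _.
  by rewrite patchE indicE; case: ifP => _; rewrite ?mulr1 ?mulr0.
have mfA : measurable_fun [set: g_sigma_algebraType F]
    (fun t => f t * \1_A t)%R.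
  by apply: measurable_funM => //; exact: measurable_indic.
have mfAT : measurable_fun setT (fun t => f t * \1_A t)%R.
  exact: measurable_fun_g_sigma_algebra mfA.
rewrite !integral_setE.
transitivity (\int[P]_t (f t * \1_A t * g t)%:E).
  by apply: eq_integral => t _; rewrite mulrAC.
apply: (ge0_integralM_indep mfAT mg) => //.
  exact: indep_funs_g_sigma_algebra mfA.
by move=> t; rewrite /= mulr_ge0.
Qed.

Lemma ge0_integral_mix_indep_le F (A : set T) (g a h : T -> R) :
  F `<=` measurable -> <<s F >> A ->
  measurable_fun [set: g_sigma_algebraType F] g -> (forall t, (0 <= g t)%R) ->
  measurable_fun [set: g_sigma_algebraType F] a ->
  (forall t, (0 <= a t <= 1)%R) ->
  measurable_fun setT h -> (forall t, (0 <= h t)%R) ->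
  indep_sets P <<s F >> (g_sigma_algebra_preimage h) ->
  \int[P]_t (h t)%:E <= 1 ->
  \int[P]_(t in A) (g t * (a t * h t + (1 - a t)))%:E <=
  \int[P]_(t in A) (g t)%:E.
Proof.
move=> Fm FA mg g0 ma a01 mh h0 Fh Eh.
have mA : measurable A by exact: g_sigma_algebra_measurable FA.
have mgT : measurable_fun setT g by exact: measurable_fun_g_sigma_algebra mg.
have maT : measurable_fun setT a by exact: measurable_fun_g_sigma_algebra ma.
have ga0 t : (0 <= g t * a t)%R by have /andP[a0 _] := a01 t; rewrite mulr_ge0.
have gonem0 t : (0 <= g t * (1 - a t))%R.
  by have /andP[_ a1] := a01 t; rewrite mulr_ge0// subr_ge0.
have mga : measurable_fun setT (fun t => g t * a t)%R by exact: measurable_funM.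
have mgonem : measurable_fun setT (fun t => g t * (1 - a t))%R.
  by apply: measurable_funM => //; exact: measurable_funB.
have -> : \int[P]_(t in A) (g t)%:E =
    \int[P]_(t in A) (g t * a t)%:E + \int[P]_(t in A) (g t * (1 - a t))%:E.
  rewrite -ge0_integral_EFinD//.
  by apply: eq_integral => t _; congr (_%:E); ring.
under eq_integral do rewrite mulrDr mulrA.
rewrite ge0_integral_EFinD//; last 2 first.
- exact: measurable_funM.
- by move=> t; rewrite mulr_ge0.
rewrite leeD2r// (ge0_integral_setM_indep Fm FA _ ga0 mh h0 Fh); last first.
  exact: measurable_funM.
rewrite -[leRHS]mule1 lee_wpmul2l// integral_ge0// => t _.
by rewrite lee_fin.
Qed.

Lemma ge0_integral_expR_indep_le F (A : set T) g a z :
  F `<=` measurable -> <<s F >> A ->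
  measurable_fun [set: g_sigma_algebraType F] g -> (forall t, (0 <= g t)%R) ->
  measurable_fun [set: g_sigma_algebraType F] a ->
  (forall t, (0 <= a t <= 1)%R) ->
  measurable_fun setT z -> indep_sets P <<s F >> (g_sigma_algebra_preimage z) ->
  \int[P]_t (expR (z t))%:E <= 1 ->
  \int[P]_(t in A) (g t * expR (a t * z t))%:E <= \int[P]_(t in A) (g t)%:E.
Proof.
move=> Fm FA mg g0 ma a01 mz Fz Ez.
have mA : measurable A by exact: g_sigma_algebra_measurable FA.
have mgT : measurable_fun setT g by exact: measurable_fun_g_sigma_algebra mg.
have maT : measurable_fun setT a by exact: measurable_fun_g_sigma_algebra ma.
have mez : measurable_fun setT (expR \o z) by exact: measurableT_comp.
apply: (@le_trans _ _
  (\int[P]_(t in A) (g t * (a t * expR (z t) + (1 - a t)))%:E)).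
  apply: ge0_le_integral_EFin => //.
  - apply: measurable_funM => //; apply: measurableT_comp => //.
    exact: measurable_funM.
  - apply: measurable_funM => //; apply: measurable_funD.
      exact: measurable_funM.
    exact: measurable_funB.
  - by move=> t; rewrite mulr_ge0// expR_ge0.
  - by move=> t; rewrite ler_wpM2l// expR_le_convex01.
apply: (ge0_integral_mix_indep_le (h := expR \o z) Fm) => //.
  by move=> t; rewrite /= expR_ge0.
by apply: indep_setsS Fz => //; exact: g_sigma_algebra_preimage_comp.
Qed.

End exponential_supermartingale_step.

Section exponential_supermartingale.
Context {d : measure_display} {T : measurableType d} {R : realType}.
Variables (P : probability T R) (G : nat -> set_system T) (a z : nat -> T -> R).
Hypothesis filtG : filtration G.
Hypothesis a_adapted : adapted G a.
Hypothesis a01 : forall n t, 0 <= a n t <= 1.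
Hypothesis z_adapted : adapted (G \o S) z.
Hypothesis indep_z :
  forall n, indep_sets P <<s G n >> (g_sigma_algebra_preimage (z n)).
Hypothesis int_expR_z : forall n, (\int[P]_t (expR (z n t))%:E <= 1)%E.
Local Open Scope ereal_scope.

Lemma supermartingale_expR_transform :
  supermartingale P G (fun n t => expR (\sum_(k < n) a k t * z k t)).
Proof.
have adapted_sum : adapted G (fun n t => \sum_(k < n) a k t * z k t)%R.
  move=> n; apply: measurable_sum => k.
  have kn := filtration_le filtG (ltn_ord k).
  apply: measurable_funM; apply: (measurable_fun_g_sigma_algebraS kn).
    exact: (measurable_fun_g_sigma_algebraS (filtG.2 k)).
  exact: z_adapted.
split=> [n|n A GA]; first exact: measurableT_comp.
under eq_integral do rewrite big_ord_recr/= expRD.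
apply: (ge0_integral_expR_indep_le (F := G n)) => //.
- exact: filtG.1.
- exact: measurableT_comp.
- apply: (measurable_fun_g_sigma_algebra (filtG.1 n.+1)); exact: z_adapted.
Qed.

Lemma transform_exceeds_le (v : R) :
  P (\bigcup_n [set t | (v < \sum_(k < n) a k t * z k t)%R]) <=
  (expR (- v))%:E.
Proof.
under eq_bigcupr do under eq_set do rewrite -ltr_expR.
rewrite expRN -[leRHS]mule1 lee_pdivlMl ?expR_gt0//.
apply: le_trans
  (supermartingale_maximal_ineq filtG supermartingale_expR_transform _ _) _.
- by move=> n t; exact: expR_ge0.
- exact: expR_ge0.
- under eq_integral do rewrite big_ord0 expR0.
  by rewrite integral_cst// mul1e; exact: probability_le1.
Qed.

End exponential_supermartingale.

Section setI_class.
Context {d : measure_display} {T : measurableType d}.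
Implicit Types F G : set_system T.

Definition setI_class F G : set_system T := [set A `&` B | A in F & B in G].

Lemma setI_closed_setI_class F G :
  setI_closed F -> setI_closed G -> setI_closed (setI_class F G).
Proof.
move=> FI GI _ _ [A FA [B GB <-]] [A' FA' [B' GB' <-]].
rewrite setIACA; exists (A `&` A'); first exact: FI.
by exists (B `&` B'); first exact: GI.
Qed.

Lemma setI_class_measurable F G :
  F `<=` measurable -> G `<=` measurable -> setI_class F G `<=` measurable.
Proof. by move=> Fm Gm _ [A /Fm mA [B /Gm mB <-]]; exact: measurableI. Qed.

Lemma setI_classS F F' G G' :
  F `<=` F' -> G `<=` G' -> setI_class F G `<=` setI_class F' G'.
Proof.
by move=> FF GG _ [A /FF FA [B /GG GB <-]]; exists A => //; exists B.
Qed.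

Lemma sub_setI_classl F G : G setT -> F `<=` setI_class F G.
Proof. by move=> GT A FA; exists A => //; exists setT; rewrite ?setIT. Qed.

Lemma sub_setI_classr F G : F setT -> G `<=` setI_class F G.
Proof. by move=> FT A GA; exists setT => //; exists A; rewrite ?setTI. Qed.

End setI_class.

Section gen_sigma.
Context {d : measure_display} {T : measurableType d} {R : realType}.
Variables (P : probability T R) (X : nat -> T -> R).
Hypothesis mX : forall i, measurable_fun setT (X i).
Implicit Types I J : set nat.

Lemma gen_sigma_measurable I : gen_sigma I X `<=` measurable.
Proof.
apply: g_sigma_algebra_measurable => _ [i [_ [B [mB ->]]]].
by rewrite -[X in measurable X]setTI; exact: mX.
Qed.

Lemma sub_gen_sigma I J : I `<=` J -> gen_sigma I X `<=` gen_sigma J X.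
Proof.
by move=> IJ; apply: sub_sigma_algebra2 => A [i [/IJ Ji iB]]; exists i.
Qed.

Lemma gen_sigma_preimage I i (B : set R) :
  I i -> measurable B -> gen_sigma I X (X i @^-1` B).
Proof.
by move=> Ii mB; apply: sub_sigma_algebra; exists i; split => //; exists B.
Qed.

Lemma measurable_fun_gen_sigma I i (F : set_system T) :
  I i -> gen_sigma I X `<=` F ->
  measurable_fun [set: g_sigma_algebraType F] (X i).
Proof.
move=> Ii IF _ B mB; rewrite setTI.
by apply: sub_sigma_algebra; apply: IF; exact: gen_sigma_preimage.
Qed.

Lemma gen_sigma_set0 : gen_sigma set0 X `<=` [set set0; setT].
Proof.
apply: smallest_sub => [|A [i [//]]]; split => [|A [|] ->|F FT]; first by left.
- by right; rewrite setD0.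
- by left; rewrite setDv.
have [[n Fn]|F0] := pselect (exists n, F n = setT).
  by right; apply/seteqP; split => // t _; exists n => //; rewrite Fn.
left; rewrite bigcup0// => n _; have [//|Fn] := FT n.
by exfalso; apply: F0; exists n.
Qed.

Lemma indep_sets_gen_sigma_set0 (G : set_system T) :
  G `<=` measurable -> indep_sets P (gen_sigma set0 X) G.
Proof.
move=> Gm; apply: indep_setsS (indep_sets_trivial P Gm) => //.
exact: gen_sigma_set0.
Qed.

Lemma m_dependent_past m k : m_dependent P m X ->
  indep_sets P (gen_sigma [set i | (i + m < k)%N] X) (gen_sigma [set k] X).
Proof.
move=> Xm; have [mk|km] := ltnP m k.
  apply: indep_setsS (Xm (k - m.+1)%N m.+1 (leqnn _)).
  - by apply: sub_gen_sigma => i /=; lia.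
  - by apply: sub_gen_sigma => i /= ->; lia.
have -> : [set i | (i + m < k)%N] = set0 by apply/seteqP; split => i //=; lia.
exact/indep_sets_gen_sigma_set0/gen_sigma_measurable.
Qed.

Definition cylinders k : set_system T :=
  [set \big[setI/setT]_(i < k) A i |
    A in [set A | forall i, (i < k)%N -> gen_sigma [set i] X (A i)]].

Lemma cylinders_measurable k : cylinders k `<=` measurable.
Proof.
move=> _ [A GA <-]; apply: bigsetI_measurable => i _.
by apply: gen_sigma_measurable; exact: GA.
Qed.

Lemma cylindersI k : setI_closed (cylinders k).
Proof.
move=> _ _ [A GA <-] [B GB <-]; exists (fun i => A i `&` B i).
  by move=> i ik; apply: g_sigma_algebraI; [exact: GA|exact: GB].
by rewrite big_split.
Qed.

Lemma cylindersT k : cylinders k setT.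
Proof.
by exists (fun=> setT); [move=> i _; exact: g_sigma_algebraT|rewrite big1].
Qed.

Lemma sub_gen_sigma_cylinders k :
  gen_sigma [set i | (i < k)%N] X `<=` <<s cylinders k >>.
Proof.
apply: sub_sigma_algebra2 => _ [i [ik [B [mB ->]]]].
exists (fun j => if j == i then X i @^-1` B else setT) => [j _|].
  by case: eqP => [->|_]; [exact: gen_sigma_preimage|exact: g_sigma_algebraT].
rewrite (bigD1 (Ordinal ik))//= eqxx big1 ?setIT// => j ji.
by rewrite ifN.
Qed.

Lemma mutually_indep_past k : mutually_indep P X ->
  indep_sets P (gen_sigma [set i | (i < k)%N] X) (gen_sigma [set k] X).
Proof.
move=> Xind; suff : indep_sets P <<s cylinders k >> (gen_sigma [set k] X).
  by apply: indep_setsS => //; exact: sub_gen_sigma_cylinders.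
apply: indep_sets_g_sigma_algebral; [exact: cylinders_measurable|
  exact: gen_sigma_measurable|exact: cylindersI|exact: cylindersT|].
move=> _ C [A GA <-] GC; pose AC i := if (i < k)%N then A i else C.
have AC_lt (i : 'I_k) : AC i = A i by rewrite /AC ltn_ord.
have AC_k : AC k = C by rewrite /AC ltnn.
have <- : \big[setI/setT]_(i < k.+1) AC i = \big[setI/setT]_(i < k) A i `&` C.
  by rewrite big_ord_recr /= AC_k; under eq_bigr do rewrite AC_lt.
rewrite Xind; last first.
  move=> i; rewrite ltnS leq_eqVlt => /predU1P[->|ik]; first by rewrite AC_k.
  by rewrite /AC ik; exact: GA.
rewrite big_ord_recr /= AC_k (Xind k A GA); congr (_ * _)%E.
by apply: eq_bigr => i _; rewrite AC_lt.
Qed.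

End gen_sigma.

Section independent_sequences.
Context {d : measure_display} {T : measurableType d} {R : realType}.
Variables (P : probability T R) (X Y Z : nat -> T -> R).
Hypothesis mX : forall n, measurable_fun setT (X n).
Hypothesis mY : forall n, measurable_fun setT (Y n).
Hypothesis mZ : forall n, measurable_fun setT (Z n).
Hypothesis XYZ : indep3 P X Y Z.
Implicit Types I J K : set nat.

Definition joint_pi_system I J K : set_system T :=
  setI_class (setI_class (gen_sigma I X) (gen_sigma J Y)) (gen_sigma K Z).

Lemma joint_pi_systemS I J K I' J' K' : I `<=` I' -> J `<=` J' -> K `<=` K' ->
  joint_pi_system I J K `<=` joint_pi_system I' J' K'.
Proof. by move=> II JJ KK; do 2?[apply: setI_classS]; exact: sub_gen_sigma. Qed.

Lemma joint_pi_system_measurable I J K : joint_pi_system I J K `<=` measurable.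
Proof. by do 2?[apply: setI_class_measurable]; exact: gen_sigma_measurable. Qed.

Lemma joint_pi_systemI I J K : setI_closed (joint_pi_system I J K).
Proof. by do 2?[apply: setI_closed_setI_class]; exact: g_sigma_algebraI. Qed.

Lemma joint_pi_systemT I J K : joint_pi_system I J K setT.
Proof. by do 2?[apply: sub_setI_classl]; exact: g_sigma_algebraT. Qed.

Lemma measurable_fun_joint_pi_system1 I J K i : I i ->
  measurable_fun [set: g_sigma_algebraType (joint_pi_system I J K)] (X i).
Proof.
move=> Ii; apply: (measurable_fun_gen_sigma Ii) => A XA.
do 2![apply: sub_setI_classl; first exact: g_sigma_algebraT]; exact: XA.
Qed.

Lemma measurable_fun_joint_pi_system2 I J K j : J j ->
  measurable_fun [set: g_sigma_algebraType (joint_pi_system I J K)] (Y j).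
Proof.
move=> Jj; apply: (measurable_fun_gen_sigma Jj) => A YA.
apply: sub_setI_classl; first exact: g_sigma_algebraT.
by apply: sub_setI_classr; first exact: g_sigma_algebraT.
Qed.

Lemma measurable_fun_joint_pi_system3 I J K k : K k ->
  measurable_fun [set: g_sigma_algebraType (joint_pi_system I J K)] (Z k).
Proof.
move=> Kk; apply: (measurable_fun_gen_sigma Kk) => A ZA.
apply: sub_setI_classr => //.
by apply: sub_setI_classl; exact: g_sigma_algebraT.
Qed.

Lemma indep_joint_pi_system I J K I' J' K' :
  indep_sets P (gen_sigma I X) (gen_sigma I' X) ->
  indep_sets P (gen_sigma J Y) (gen_sigma J' Y) ->
  indep_sets P (gen_sigma K Z) (gen_sigma K' Z) ->
  indep_sets P <<s joint_pi_system I J K >> <<s joint_pi_system I' J' K' >>.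
Proof.
move=> indX indY indZ; apply: indep_sets_g_sigma_algebra;
  [exact: joint_pi_system_measurable..|exact: joint_pi_systemI|
   exact: joint_pi_systemT|exact: joint_pi_systemI|exact: joint_pi_systemT|].
have sub_full V L : gen_sigma L V `<=` @gen_sigma _ T R setT V.
  exact: sub_gen_sigma.
have full_setI V L L' A A' : gen_sigma L V A -> gen_sigma L' V A' ->
    @gen_sigma _ T R setT V (A `&` A').
  by move=> /sub_full VA /sub_full VA'; exact: g_sigma_algebraI.
move=> _ _ [_ [A GA [B GB <-]] [C GC <-]] [_ [A' GA' [B' GB' <-]] [C' GC' <-]].
rewrite [in LHS]setIACA (setIACA A).
rewrite XYZ;
  [|exact: full_setI GA GA'|exact: full_setI GB GB'|exact: full_setI GC GC'].
rewrite indX// indY// indZ//.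
rewrite (XYZ (sub_full _ _ _ GA) (sub_full _ _ _ GB) (sub_full _ _ _ GC)).
rewrite (XYZ (sub_full _ _ _ GA') (sub_full _ _ _ GB') (sub_full _ _ _ GC')).
by rewrite [RHS]muleACA (muleACA (P A) (P B)).
Qed.

Let indep_trivial (V : nat -> T -> R) I :
  (forall n, measurable_fun setT (V n)) ->
  indep_sets P (gen_sigma set0 V) (gen_sigma I V).
Proof. by move=> mV; exact/indep_sets_gen_sigma_set0/gen_sigma_measurable. Qed.

Lemma indep3_indep_funs n : indep_funs P (X n) (Y n).
Proof.
have indG : indep_sets P <<s joint_pi_system [set n] set0 set0 >>
    <<s joint_pi_system set0 [set n] set0 >>.
  by apply: indep_joint_pi_system;
    [exact/indep_setsC/indep_trivial|exact: indep_trivial..].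
apply: indep_setsS indG; apply: g_sigma_algebra_preimage_sub.
  exact: measurable_fun_joint_pi_system1.
exact: measurable_fun_joint_pi_system2.
Qed.

Lemma indep3_indep_funs_pair n : indep_funs P (fun t => (X n t, Y n t)) (Z n).
Proof.
have indG : indep_sets P <<s joint_pi_system [set n] [set n] set0 >>
    <<s joint_pi_system set0 set0 [set n] >>.
  by apply: indep_joint_pi_system;
    [exact/indep_setsC/indep_trivial..|exact: indep_trivial].
apply: indep_setsS indG; apply: g_sigma_algebra_preimage_sub.
  apply: measurable_fun_pair.
    exact: measurable_fun_joint_pi_system1.
  exact: measurable_fun_joint_pi_system2.
exact: measurable_fun_joint_pi_system3.
Qed.

Lemma indep3_same_law n :
  ident_distr P X -> ident_distr P Y -> ident_distr P Z ->
  same_law P (fun t => (X n t, Y n t, Z n t)) (fun t => (X 0 t, Y 0 t, Z 0 t)).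
Proof.
move=> Xid Yid Zid.
have mXY k : measurable_fun setT (fun t => (X k t, Y k t)).
  exact: measurable_fun_pair.
apply: same_law_pair => //; [exact: indep3_indep_funs_pair..| |exact: Zid].
by apply: same_law_pair => //;
  [exact: indep3_indep_funs..|exact: Xid|exact: Yid].
Qed.

End independent_sequences.

Section discounting.
Context {T : Type} {R : realType}.
Implicit Types (X Y I : nat -> T -> R) (t : T).

Definition discount I n t : R := \prod_(j < n) (1 + I j t)^-1.

Definition loss X Y I n t : R := Y n t / (1 + I n t) - X n t.

Definition class_loss X Y I k r q t : R :=
  \sum_(l < q) discount I (l * k.+1 + r) t * loss X Y I (l * k.+1 + r) t.

Lemma discount_gt0 I n t : (forall j, 0 <= I j t) -> 0 < discount I n t.
Proof. by move=> I0; apply: prodr_gt0 => j _; rewrite invr_gt0 ltr_pwDl. Qed.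

Lemma discount_le1 I n t : (forall j, 0 <= I j t) -> discount I n t <= 1.
Proof.
move=> I0; apply: prodr_ile1 => j; rewrite invr_ge0 addr_ge0//=.
by rewrite invf_le1 ?ltr_pwDl// lerDl.
Qed.

End discounting.

Section discounted_surplus.
Context {d : measure_display} {T : measurableType d} {R : realType}.
Implicit Types (X Y I : nat -> T -> R) (u : R) (t : T).

Lemma surplus_discount X Y I u n t : (forall j, 0 <= I j t) ->
  surplus X Y I u n t * discount I n t =
  u - \sum_(i < n) discount I i t * loss X Y I i t.
Proof.
move=> I0; elim: n => [|n IHn].
  by rewrite /discount !big_ord0 mulr1 subr0.
have discountS : discount I n.+1 t = discount I n t * (1 + I n t)^-1.
  by rewrite /discount big_ord_recr.
have I_neq0 : 1 + I n t != 0 by rewrite lt0r_neq0// ltr_pwDl.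
by rewrite big_ord_recr/= opprD addrA -IHn discountS /loss; field.
Qed.

Lemma surplus_lt0_class_loss X Y I u k n t : (forall j, 0 <= I j t) ->
  surplus X Y I u n t < 0 ->
  exists r q, (r < k.+1)%N /\ u / k.+1%:R < class_loss X Y I k r q t.
Proof.
move=> I0; rewrite -(pmulr_llt0 _ (discount_gt0 n I0)) surplus_discount//.
pose discounted_loss i := discount I i t * loss X Y I i t.
rewrite subr_lt0 (sum_residue_classes discounted_loss k).
apply: contraPP => noclass; apply/negP; rewrite -leNgt.
have -> : u = \sum_(r < k.+1) u / k.+1%:R.
  by rewrite sumr_const card_ord -[RHS]mulr_natr divfK// pnatr_eq0.
apply: ler_sum => r _; rewrite leNgt; apply/negP => class_gt.
by apply: noclass; exists r, ((n + k - r) %/ k.+1)%N.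
Qed.

Lemma measurable_discount I n :
  (forall j, (j < n)%N -> measurable_fun setT (I j)) ->
  measurable_fun setT (discount I n).
Proof.
move=> mI; apply: measurable_prod => j _; apply: measurable_funV.
by apply: measurable_funD => //; exact: mI.
Qed.

Lemma measurable_loss X Y I n :
  measurable_fun setT (X n) -> measurable_fun setT (Y n) ->
  measurable_fun setT (I n) -> measurable_fun setT (loss X Y I n).
Proof.
move=> mX mY mI; apply: measurable_funB => //; apply: measurable_funM => //.
by apply: measurable_funV; exact: measurable_funD.
Qed.

Lemma measurable_class_loss X Y I k r q :
  (forall i, measurable_fun setT (X i)) ->
  (forall i, measurable_fun setT (Y i)) ->
  (forall i, measurable_fun setT (I i)) ->
  measurable_fun setT (class_loss X Y I k r q).
Proof.
move=> mX mY mI; apply: measurable_sum => l; apply: measurable_funM.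
  exact: measurable_discount.
exact: measurable_loss.
Qed.

Lemma measurable_surplus X Y I u n :
  (forall i, measurable_fun setT (X i)) ->
  (forall i, measurable_fun setT (Y i)) ->
  (forall i, measurable_fun setT (I i)) ->
  measurable_fun setT (surplus X Y I u n).
Proof.
move=> mX mY mI; elim: n => [|n IHn] /=; first exact: measurable_cst.
by apply: measurable_funB => //; apply: measurable_funM; exact: measurable_funD.
Qed.

End discounted_surplus.

Section ruin.
Context {d : measure_display} {T : measurableType d} {R : realType}.
Variables (P : probability T R) (m : nat) (X Y I : nat -> T -> R).
Hypothesis mX : forall n, measurable_fun setT (X n).
Hypothesis mY : forall n, measurable_fun setT (Y n).
Hypothesis mI : forall n, measurable_fun setT (I n).
Hypothesis I_ge0 : forall n t, 0 <= I n t.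
Hypothesis XYI : indep3 P X Y I.

Lemma integral_expR_loss (c : R) n :
  ident_distr P X -> ident_distr P Y -> ident_distr P I ->
  (\int[P]_t (expR (c * loss X Y I n t))%:E =
   \int[P]_t (expR (c * loss X Y I 0 t))%:E)%E.
Proof.
move=> Xid Yid Iid.
pose h (z : R * R * R) := (expR (c * (z.1.2 / (1 + z.2) - z.1.1)))%:E.
have mz11 : measurable_fun setT (fun z : R * R * R => z.1.1).
  exact: measurableT_comp measurable_fst measurable_fst.
have mz12 : measurable_fun setT (fun z : R * R * R => z.1.2).
  exact: measurableT_comp measurable_snd measurable_fst.
have mh : measurable_fun setT h.
  apply/measurable_EFinP; apply: measurableT_comp => //.
  apply: measurable_funM => //; apply: measurable_funB => //.
  apply: measurable_funM => //.
  by apply: measurable_funV; apply: measurable_funD => //;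
    exact: measurable_snd.
have mXYI k : measurable_fun setT (fun t => (X k t, Y k t, I k t)).
  by do 2?[apply: measurable_fun_pair].
apply: (ge0_integral_same_law (h := h) (mXYI n) (mXYI 0)) => //.
  exact: indep3_same_law.
by move=> z; rewrite lee_fin expR_ge0.
Qed.

Hypothesis Xdep : m_dependent P m X.
Hypothesis Ydep : m_dependent P m Y.
Hypothesis Iind : mutually_indep P I.

Definition past k : set_system T :=
  joint_pi_system X Y I [set i | (i + m < k)%N] [set i | (i + m < k)%N]
    [set i | (i < k)%N].

Lemma filtration_past r : filtration (fun l => past (l * m.+1 + r)).
Proof.
split=> [l|l]; first exact: joint_pi_system_measurable.
apply: sub_sigma_algebra2; apply: joint_pi_systemS => i /=; lia.
Qed.

Lemma measurable_past_discount n :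
  measurable_fun [set: g_sigma_algebraType (past n)] (discount I n).
Proof.
apply: (@measurable_discount _ (g_sigma_algebraType (past n))) => j jn.
exact: measurable_fun_joint_pi_system3.
Qed.

Lemma measurable_past_loss k n : (k + m < n)%N ->
  measurable_fun [set: g_sigma_algebraType (past n)] (loss X Y I k).
Proof.
move=> kn; apply: (@measurable_loss _ (g_sigma_algebraType (past n))).
- exact: measurable_fun_joint_pi_system1.
- exact: measurable_fun_joint_pi_system2.
- by apply: measurable_fun_joint_pi_system3 => /=; lia.
Qed.

Lemma indep_past_loss n :
  indep_sets P <<s past n >> (g_sigma_algebra_preimage (loss X Y I n)).
Proof.
pose present := joint_pi_system X Y I [set n] [set n] [set n].
have : indep_sets P <<s past n >> <<s present >>.
  apply: indep_joint_pi_system => //; [exact: m_dependent_past..|].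
  exact: mutually_indep_past.
apply: indep_setsS => //; apply: g_sigma_algebra_preimage_sub.
apply: (@measurable_loss _ (g_sigma_algebraType present)).
- exact: measurable_fun_joint_pi_system1.
- exact: measurable_fun_joint_pi_system2.
- exact: measurable_fun_joint_pi_system3.
Qed.

Lemma class_loss_exceeds_le (c v : R) r : 0 < c ->
  (forall n, \int[P]_t (expR (c * loss X Y I n t))%:E <= 1)%E ->
  (P (\bigcup_q [set t | (v < class_loss X Y I m r q t)%R])
    <= (expR (- (c * v)))%:E)%E.
Proof.
move=> c0 Eloss; pose i l := (l * m.+1 + r)%N.
have class_lossZ q t : c * class_loss X Y I m r q t =
    \sum_(l < q) discount I (i l) t * (c * loss X Y I (i l) t).
  by rewrite mulr_sumr; apply: eq_bigr => l _; rewrite mulrCA.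
under eq_bigcupr do under eq_set do rewrite -(ltr_pM2l c0) class_lossZ.
apply: (transform_exceeds_le (G := past \o i) (a := discount I \o i)
  (z := fun l t => c * loss X Y I (i l) t)) => [|l|l t|l|l|l].
- exact: filtration_past.
- exact: measurable_past_discount.
- by rewrite ltW ?discount_gt0// discount_le1.
- by apply: measurable_funM => //; apply: measurable_past_loss; rewrite /i; lia.
- apply: indep_setsS (indep_past_loss (n := i l)) => //.
  apply: (g_sigma_algebra_preimage_comp (h := *%R c)).
  exact: mulrl_measurable.
- exact: Eloss.
Qed.

Lemma ruin_prob_le (c u : R) : 0 < c ->
  (forall n, \int[P]_t (expR (c * loss X Y I n t))%:E <= 1)%E ->
  (ruin_prob P X Y I u <= (m.+1%:R * expR (- (c * (u / m.+1%:R))))%:E)%E.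
Proof.
move=> c0 Eloss.
pose class_exceeds r :=
  \bigcup_q [set t | u / m.+1%:R < class_loss X Y I m r q t].
have mclass_exceeds r : measurable (class_exceeds r).
  apply: bigcup_measurable => q _.
  by apply: measurable_superlevel; exact: measurable_class_loss.
have ruin_class : \bigcup_n [set t | surplus X Y I u n.+1 t < 0] `<=`
    \big[setU/set0]_(r < m.+1) class_exceeds r.
  move=> t [n _ U_lt0].
  have [//|r [q [rm rq]]] := surplus_lt0_class_loss m _ U_lt0.
  by rewrite -bigcup_mkord; exists r => //; exists q.
apply: (@le_trans _ _ (P (\big[setU/set0]_(r < m.+1) class_exceeds r))).
  apply: le_measure => //; rewrite inE; last exact: bigsetU_measurable.
  apply: bigcup_measurable => n _; under eq_set do rewrite -oppr_gt0.
  by apply: measurable_superlevel; apply: measurable_funN;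
    exact: measurable_surplus.
apply: le_trans (Boole_inequality _ _) _ => //.
apply: (@le_trans _ _ (\sum_(r < m.+1) (expR (- (c * (u / m.+1%:R))))%:E)%E).
  by apply: lee_sum => r _; exact: class_loss_exceeds_le.
by rewrite sumEFin lee_fin sumr_const card_ord mulr_natl.
Qed.

End ruin.

Theorem theorem3p1 (d : measure_display) (T : measurableType d) (R : realType)
  (P : probability T R) (m : nat)
  (X Y I : nat -> {RV P >-> R})
  (hX0 : forall n t, 0 <= X n t) (hY0 : forall n t, 0 <= Y n t)
  (hI0 : forall n t, 0 <= I n t)
  (hXint : forall n, P.-integrable setT (EFin \o X n))
  (hYint : forall n, P.-integrable setT (EFin \o Y n))
  (hIint : forall n, P.-integrable setT (EFin \o I n))
  (hXid : ident_distr P (fun n => X n)) (hYid : ident_distr P (fun n => Y n))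
  (hIid : ident_distr P (fun n => I n))
  (hXdep : m_dependent P m (fun n => X n))
  (hYdep : m_dependent P m (fun n => Y n))
  (hIind : mutually_indep P (fun n => I n))
  (hind : indep3 P (fun n => X n) (fun n => Y n) (fun n => I n))
  (Rc : R) (hR : 0 < Rc)
  (hLund : (\int[P]_t (expR (Rc * (Y 0%N t / (1 + I 0%N t) - X 0%N t)))%:E
            <= 1)%E) :
  forall u : R, (m.+1)%:R * ln (m.+1)%:R / Rc < u ->
    (ruin_prob P (fun n => X n) (fun n => Y n) (fun n => I n) u
      <= ((m.+1)%:R * expR (- Rc * u / (m.+1)%:R))%:E)%E.
Proof.
move=> u _; rewrite !mulNr -mulrA; apply: ruin_prob_le => // n.
by rewrite integral_expR_loss.
Qed.
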